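(* Let $(\mathcal{A},\mathcal{B},l_{\mathcal{A}},r_{\mathcal{A}},l_{\mathcal{B}},r_{\mathcal{B}},\alpha_{\mathcal{A}},\alpha_{\mathcal{B}})$ be a matched pair of hom-center-symmetric algebras $(\mathcal{A},\cdot,\alpha_{\mathcal{A}})$ and $(\mathcal{B},\circ,\alpha_{\mathcal{B}})$. Then $(\mathcal{G}(\mathcal{A}),\mathcal{G}(\mathcal{B}),l_{\mathcal{A}}-r_{\mathcal{A}},l_{\mathcal{B}}-r_{\mathcal{B}},\alpha_{\mathcal{A}},\alpha_{\mathcal{B}})$ is a matched pair of the sub-adjacent hom-Lie algebras $\mathcal{G}(\mathcal{A})_{\alpha_{\mathcal{A}}}$ and $\mathcal{G}(\mathcal{B})_{\alpha_{\mathcal{B}}}$.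
   Context: All vector spaces are over a field $\mathbb{K}$; $\mathfrak{gl}(V)$ denotes the space of linear endomorphisms of $V$. A hom-center-symmetric algebra is a triple $(\mathcal{A},\mu,\alpha)$ (with $xy=\mu(x,y)$) with $\mathcal{A}$ a vector space, $\mu$ bilinear and $\alpha\in\mathfrak{gl}(\mathcal{A})$ such that for all $x,y,z$: $\alpha(xy)=\alpha(x)\alpha(y)$ and $(x,y,z)_\alpha=(z,y,x)_\alpha$, where $(x,y,z)_\alpha:=(xy)\alpha(z)-\alpha(x)(yz)$. Its sub-adjacent hom-Lie algebra is $\mathcal{G}(\mathcal{A})_\alpha=(\mathcal{A},[\cdot,\cdot],\alpha)$, $[x,y]=xy-yx$. $(l,r,V,\varphi)$, with $l,r:\mathcal{A}\to\mathfrak{gl}(V)$ linear and $\varphi\in\mathfrak{gl}(V)$, is a bimodule of $(\mathcal{A},\alpha)$ if for all $x,y\in\mathcal{A}$: $\varphi l_x=l_{\alpha(x)}\varphi$, $\varphi r_x=r_{\alpha(x)}\varphi$; $l_{\alpha(x)}l_y-l_{xy}\varphi=r_{yx}\varphi-r_{\alpha(x)}r_y$; $l_{\alpha(x)}r_y-r_{\alpha(y)}l_x=l_{\alpha(y)}r_x-r_{\alpha(x)}l_y$. Matched pair of hom-center-symmetric algebras: linear maps $l_{\mathcal{A}},r_{\mathcal{A}}:\mathcal{A}\to\mathfrak{gl}(\mathcal{B})$, $l_{\mathcal{B}},r_{\mathcal{B}}:\mathcal{B}\to\mathfrak{gl}(\mathcal{A})$ such that $(l_{\mathcal{A}},r_{\mathcal{A}},\mathcal{B},\alpha_{\mathcal{B}})$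 is a bimodule of $\mathcal{A}$, $(l_{\mathcal{B}},r_{\mathcal{B}},\mathcal{A},\alpha_{\mathcal{A}})$ is a bimodule of $\mathcal{B}$, and for all $x,y\in\mathcal{A}$, $a,b\in\mathcal{B}$: (i) $(l_{\mathcal{B}}(a)x)\cdot\alpha_{\mathcal{A}}(y)+l_{\mathcal{B}}(r_{\mathcal{A}}(x)a)(\alpha_{\mathcal{A}}(y))-l_{\mathcal{B}}(\alpha_{\mathcal{B}}(a))(x\cdot y)-r_{\mathcal{B}}(\alpha_{\mathcal{B}}(a))(y\cdot x)+\alpha_{\mathcal{A}}(y)\cdot(r_{\mathcal{B}}(a)x)+r_{\mathcal{B}}(l_{\mathcal{A}}(x)a)(\alpha_{\mathcal{A}}(y))=0$; (ii) $(r_{\mathcal{B}}(a)x)\cdot\alpha_{\mathcal{A}}(y)+l_{\mathcal{B}}(l_{\mathcal{A}}(x)a)(\alpha_{\mathcal{A}}(y))-\alpha_{\mathcal{A}}(x)\cdot(l_{\mathcal{B}}(a)y)-r_{\mathcal{B}}(r_{\mathcal{A}}(y)a)(\alpha_{\mathcal{A}}(x))-(r_{\mathcal{B}}(a)y)\cdot\alpha_{\mathcal{A}}(x)-l_{\mathcal{B}}(l_{\mathcal{A}}(y)a)(\alpha_{\mathcal{A}}(x))+\alpha_{\mathcal{A}}(y)\cdot(l_{\mathcal{B}}(a)x)+r_{\mathcal{B}}(r_{\mathcal{A}}(x)a)(\alpha_{\mathcal{A}}(y))=0$; (iii) $(l_{\mathcal{A}}(x)a)\circ\alpha_{\mathcal{B}}(b)+l_{\mathcal{A}}(r_{\mathcal{B}}(a)x)(\alpha_{\mathcal{B}}(b))-l_{\mathcal{A}}(\alpha_{\mathcal{A}}(x))(a\circ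 b)-r_{\mathcal{A}}(\alpha_{\mathcal{A}}(x))(b\circ a)+\alpha_{\mathcal{B}}(b)\circ(r_{\mathcal{A}}(x)a)+r_{\mathcal{A}}(l_{\mathcal{B}}(a)x)(\alpha_{\mathcal{B}}(b))=0$; (iv) $(r_{\mathcal{A}}(x)a)\circ\alpha_{\mathcal{B}}(b)+l_{\mathcal{A}}(l_{\mathcal{B}}(a)x)(\alpha_{\mathcal{B}}(b))-\alpha_{\mathcal{B}}(a)\circ(l_{\mathcal{A}}(x)b)-r_{\mathcal{A}}(r_{\mathcal{B}}(b)x)(\alpha_{\mathcal{B}}(a))-(r_{\mathcal{A}}(x)b)\circ\alpha_{\mathcal{B}}(a)-l_{\mathcal{A}}(l_{\mathcal{B}}(b)x)(\alpha_{\mathcal{B}}(a))+\alpha_{\mathcal{B}}(b)\circ(l_{\mathcal{A}}(x)a)+r_{\mathcal{A}}(r_{\mathcal{B}}(a)x)(\alpha_{\mathcal{B}}(b))=0$. A hom-Lie algebra is $(\mathfrak{g},[\cdot,\cdot],\alpha)$ with $[\cdot,\cdot]$ skew-symmetric bilinear, $\alpha$ an algebra homomorphism, and $[\alpha(x),[y,z]]+[\alpha(y),[z,x]]+[\alpha(z),[x,y]]=0$. A representation on $V$ with respect to $\psi\in\mathfrak{gl}(V)$ is a linear $\rho:\mathfrak{g}\to\mathfrak{gl}(V)$ with $\rho(\alpha(x))\psi=\psi\rho(x)$ and $\rho([x,y])\psi=\rho(\alpha(x))\rho(y)-\rho(\alpha(y))\rho(x)$. A matched pair of hom-Lie algebras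 $(\mathcal{G},\mathcal{H},\rho_{\mathcal{G}},\rho_{\mathcal{H}},\varphi_{\mathcal{G}},\varphi_{\mathcal{H}})$ consists of hom-Lie algebras $(\mathcal{G},[\cdot,\cdot]_{\mathcal{G}},\varphi_{\mathcal{G}})$, $(\mathcal{H},[\cdot,\cdot]_{\mathcal{H}},\varphi_{\mathcal{H}})$ with representations $\rho_{\mathcal{G}}:\mathcal{G}\to\mathfrak{gl}(\mathcal{H})$ with respect to $\varphi_{\mathcal{H}}$ and $\rho_{\mathcal{H}}:\mathcal{H}\to\mathfrak{gl}(\mathcal{G})$ with respect to $\varphi_{\mathcal{G}}$ such that for all $x,y\in\mathcal{G}$, $a,b\in\mathcal{H}$: $\rho_{\mathcal{H}}(\varphi_{\mathcal{H}}(a))[x,y]_{\mathcal{G}}=[\rho_{\mathcal{H}}(a)x,\varphi_{\mathcal{G}}(y)]_{\mathcal{G}}+[\varphi_{\mathcal{G}}(x),\rho_{\mathcal{H}}(a)y]_{\mathcal{G}}+\rho_{\mathcal{H}}(\rho_{\mathcal{G}}(y)a)(\varphi_{\mathcal{G}}(x))-\rho_{\mathcal{H}}(\rho_{\mathcal{G}}(x)a)(\varphi_{\mathcal{G}}(y))$, $\rho_{\mathcal{G}}(\varphi_{\mathcal{G}}(x))[a,b]_{\mathcal{H}}=[\rho_{\mathcal{G}}(x)a,\varphi_{\mathcal{H}}(b)]_{\mathcal{H}}+[\varphi_{\mathcal{H}}(a),\rho_{\mathcal{G}}(x)b]_{\mathcal{H}}+\rho_{\mathcal{G}}(\rho_{\mathcal{H}}(b)x)(\varphi_{\mathcal{H}}(a))-\rho_{\mathcal{G}}(\rho_{\mathcal{H}}(a)x)(\varphi_{\mathcal{H}}(b))$.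 *)

(* Defs.v *)
From HB Require Import structures.
From mathcomp Require Import all_boot all_order all_algebra.

Set Implicit Arguments.
Unset Strict Implicit.
Unset Printing Implicit Defensive.

Import GRing.Theory.
Local Open Scope ring_scope.

(* Vector spaces, of arbitrary dimension, are the modules [V : lmodType K] over
   [K : fieldType].  An element of gl(V) is a [{linear V -> V}], and a linear
   map [l : A -> gl(V)] is given in curried form as a
   [{bilinear A -> V -> V}], so that [l x] is the endomorphism written l_x. *)

Section BilinearDifference.
Variables (K : fieldType) (U V W : lmodType K).

Section Diff.
Variables l r : {bilinear U -> V -> W}.

Definition diff_bilin (u : U) (v : V) : W := l u v - r u v.

Fact diff_bilin_is_bilinear : bilinear_for *:%R *:%R diff_bilin.
Proof.
split=> [v a u u'|u a v v'] /=; rewrite /diff_bilin.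
  by rewrite (linearPl l) (linearPl r) scalerBr opprD addrACA.
by rewrite (linearPr l) (linearPr r) scalerBr opprD addrACA.
Qed.

HB.instance Definition _ :=
  bilinear_isBilinear.Build K U V W *:%R *:%R diff_bilin
    diff_bilin_is_bilinear.

End Diff.
End BilinearDifference.

Section Commutator.
Variables (K : fieldType) (A : lmodType K) (mu : {bilinear A -> A -> A}).

Definition commutator (x y : A) : A := mu x y - mu y x.

Fact commutator_is_bilinear : bilinear_for *:%R *:%R commutator.
Proof.
split=> [y a x x'|x a y y'] /=; rewrite /commutator.
  by rewrite (linearPl mu) (linearPr mu) scalerBr opprD addrACA.
by rewrite (linearPl mu) (linearPr mu) scalerBr opprD addrACA.
Qed.

HB.instance Definition _ :=
  bilinear_isBilinear.Build K A A A *:%R *:%R commutator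
    commutator_is_bilinear.

End Commutator.

Section HomCenterSymmetric.
Variable K : fieldType.

Definition hom_associator (A : lmodType K) (mu : {bilinear A -> A -> A})
    (alpha : {linear A -> A}) (x y z : A) : A :=
  mu (mu x y) (alpha z) - mu (alpha x) (mu y z).

Record hom_center_symmetric (A : lmodType K) (mu : {bilinear A -> A -> A})
    (alpha : {linear A -> A}) : Prop := HomCenterSymmetric {
  hcs_multiplicative : forall x y, alpha (mu x y) = mu (alpha x) (alpha y);
  hcs_associator : forall x y z,
    hom_associator mu alpha x y z = hom_associator mu alpha z y x
}.

Record hcs_bimodule (A : lmodType K) (mu : {bilinear A -> A -> A})
    (alpha : {linear A -> A}) (V : lmodType K)
    (l r : {bilinear A -> V -> V}) (phi : {linear V -> V}) : Prop :=
  HcsBimodule {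
  bimod_phil : forall x v, phi (l x v) = l (alpha x) (phi v);
  bimod_phir : forall x v, phi (r x v) = r (alpha x) (phi v);
  bimod_lr : forall x y v,
    l (alpha x) (l y v) - l (mu x y) (phi v)
    = r (mu y x) (phi v) - r (alpha x) (r y v);
  bimod_mixed : forall x y v,
    l (alpha x) (r y v) - r (alpha y) (l x v)
    = l (alpha y) (r x v) - r (alpha x) (l y v)
}.

(* Each of the next two conditions is imposed twice in a matched pair, the
   second time with the roles of A and B exchanged. *)
Definition hcs_matched_i (A B : lmodType K) (muA : {bilinear A -> A -> A})
    (alphaA : {linear A -> A}) (alphaB : {linear B -> B})
    (lA rA : {bilinear A -> B -> B}) (lB rB : {bilinear B -> A -> A}) : Prop :=
  forall (x y : A) (a : B),
    muA (lB a x) (alphaA y) + lB (rA x a) (alphaA y)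
    - lB (alphaB a) (muA x y) - rB (alphaB a) (muA y x)
    + muA (alphaA y) (rB a x) + rB (lA x a) (alphaA y) = 0.

Definition hcs_matched_ii (A B : lmodType K) (muA : {bilinear A -> A -> A})
    (alphaA : {linear A -> A})
    (lA rA : {bilinear A -> B -> B}) (lB rB : {bilinear B -> A -> A}) : Prop :=
  forall (x y : A) (a : B),
    muA (rB a x) (alphaA y) + lB (lA x a) (alphaA y)
    - muA (alphaA x) (lB a y) - rB (rA y a) (alphaA x)
    - muA (rB a y) (alphaA x) - lB (lA y a) (alphaA x)
    + muA (alphaA y) (lB a x) + rB (rA x a) (alphaA y) = 0.

Record hcs_matched_pair (A B : lmodType K)
    (muA : {bilinear A -> A -> A}) (muB : {bilinear B -> B -> B})
    (lA rA : {bilinear A -> B -> B}) (lB rB : {bilinear B -> A -> A})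
    (alphaA : {linear A -> A}) (alphaB : {linear B -> B}) : Prop :=
  HcsMatchedPair {
  hcs_mp_A : hom_center_symmetric muA alphaA;
  hcs_mp_B : hom_center_symmetric muB alphaB;
  hcs_mp_bimodB : hcs_bimodule muA alphaA lA rA alphaB;
  hcs_mp_bimodA : hcs_bimodule muB alphaB lB rB alphaA;
  hcs_mp_i : hcs_matched_i muA alphaA alphaB lA rA lB rB;
  hcs_mp_ii : hcs_matched_ii muA alphaA lA rA lB rB;
  hcs_mp_iii : hcs_matched_i muB alphaB alphaA lB rB lA rA;
  hcs_mp_iv : hcs_matched_ii muB alphaB lB rB lA rA
}.

End HomCenterSymmetric.

Section HomLie.
Variable K : fieldType.

Record hom_Lie (G : lmodType K) (br : {bilinear G -> G -> G})
    (alpha : {linear G -> G}) : Prop := HomLie {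
  homLie_skew : forall x y, br x y = - br y x;
  homLie_multiplicative : forall x y, alpha (br x y) = br (alpha x) (alpha y);
  homLie_jacobi : forall x y z,
    br (alpha x) (br y z) + br (alpha y) (br z x) + br (alpha z) (br x y) = 0
}.

Record homLie_repr (G : lmodType K) (br : {bilinear G -> G -> G})
    (alpha : {linear G -> G}) (V : lmodType K)
    (rho : {bilinear G -> V -> V}) (psi : {linear V -> V}) : Prop :=
  HomLieRepr {
  repr_twist : forall x v, rho (alpha x) (psi v) = psi (rho x v);
  repr_bracket : forall x y v,
    rho (br x y) (psi v)
    = rho (alpha x) (rho y v) - rho (alpha y) (rho x v)
}.

(* The compatibility over G; the one over H is obtained by exchanging the
   roles of G and H. *)
Definition homLie_matched (G H : lmodType K)
    (brG : {bilinear G -> G -> G})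
    (rhoG : {bilinear G -> H -> H}) (rhoH : {bilinear H -> G -> G})
    (phiG : {linear G -> G}) (phiH : {linear H -> H}) : Prop :=
  forall (x y : G) (a : H),
    rhoH (phiH a) (brG x y)
    = brG (rhoH a x) (phiG y) + brG (phiG x) (rhoH a y)
      + rhoH (rhoG y a) (phiG x) - rhoH (rhoG x a) (phiG y).

Record homLie_matched_pair (G H : lmodType K)
    (brG : {bilinear G -> G -> G}) (brH : {bilinear H -> H -> H})
    (rhoG : {bilinear G -> H -> H}) (rhoH : {bilinear H -> G -> G})
    (phiG : {linear G -> G}) (phiH : {linear H -> H}) : Prop :=
  HomLieMatchedPair {
  homLie_mp_G : hom_Lie brG phiG;
  homLie_mp_H : hom_Lie brH phiH;
  homLie_mp_reprG : homLie_repr brG phiG rhoG phiH;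
  homLie_mp_reprH : homLie_repr brH phiH rhoH phiG;
  homLie_mp_matchG : homLie_matched brG rhoG rhoH phiG phiH;
  homLie_mp_matchH : homLie_matched brH rhoH rhoG phiH phiG
}.

End HomLie.

(* Main.v *)
(** Once every bracket is split into its two products, the representation axiom
    is the antisymmetrization of the two mixed bimodule axioms, and each
    hom-Lie compatibility is (i) minus (i) with [x] and [y] exchanged, plus
    (ii). In the Jacobi sum each associator occurs with the sign of its
    permutation, so that [(x,y,z)] and [(z,y,x)] cancel. *)

Require Import Defs.
From HB Require Import structures.
From mathcomp Require Import all_boot all_order all_algebra.
Import GRing.Theory.
Local Open Scope ring_scope.

(** Subtracting a known equation leaves another equation as goal, so applications chain; [esym]
    flips the sign with which one enters. *)
Lemma eq_linear_combination (V : zmodType) (x y e f : V) :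
  e = f -> x - y - (e - f) = 0 -> x = y.
Proof. by move=> ->; rewrite subrr subr0 => /subr0_eq. Qed.

(* Proves [e = 0] in an abelian group when the terms of [e] cancel in pairs:
   the opposite of the head of [t1 + (t2 + (... + 0))] is pulled to the front
   and cancelled, until nothing is left. *)
Ltac zmod_cancel :=
  rewrite ?(opprD, opprK, oppr0, addr0, add0r);
  apply: (etrans (esym (addr0 _))); rewrite -?addrA;
  repeat match goal with
  | |- - ?t + _ = 0 => rewrite !(addrCA _ t) addNKr
  | |- ?t + _ = 0 => rewrite !(addrCA _ (- t)) addKr
  end; reflexivity.

Lemma commutator_hom_Lie (K : fieldType) (A : lmodType K)
    (mu : {bilinear A -> A -> A}) (alpha : {linear A -> A}) :
  hom_center_symmetric mu alpha -> hom_Lie (commutator mu) alpha.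
Proof.
case=> alphaM assocC; split=> [x y|x y|x y z] /=; rewrite /commutator.
- by rewrite opprB.
- by rewrite linearB /= !alphaM.
(* One instance per middle entry, odd permutations on the left, pairs off all six associators. *)
- apply: (eq_linear_combination _ _ _ _ _ (assocC x z y)).
  apply: (eq_linear_combination _ _ _ _ _ (assocC y x z)).
  apply: (eq_linear_combination _ _ _ _ _ (assocC z y x)).
  rewrite /hom_associator !(linearBl, linearBr) /=.
  zmod_cancel.
Qed.

Lemma hcs_bimodule_diff_repr (K : fieldType) (A : lmodType K)
    (mu : {bilinear A -> A -> A}) (alpha : {linear A -> A}) (V : lmodType K)
    (l r : {bilinear A -> V -> V}) (phi : {linear V -> V}) :
  hcs_bimodule mu alpha l r phi ->
  homLie_repr (commutator mu) alpha (diff_bilin l r) phi.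
Proof.
case=> phil phir bimodlr bimodmix; split=> [x v|x y v] /=.
  by rewrite /diff_bilin linearB /= phil phir.
apply: (eq_linear_combination _ _ _ _ _ (bimodlr y x v)).
apply: (eq_linear_combination _ _ _ _ _ (esym (bimodlr x y v))).
(* [bimodmix] is already skew in [x] and [y], so it enters once. *)
apply: (eq_linear_combination _ _ _ _ _ (bimodmix x y v)).
rewrite /diff_bilin /commutator !(linearBl, linearBr) /=.
zmod_cancel.
Qed.

Lemma hcs_matched_diff (K : fieldType) (A B : lmodType K)
    (mu : {bilinear A -> A -> A}) (lA rA : {bilinear A -> B -> B})
    (lB rB : {bilinear B -> A -> A})
    (alphaA : {linear A -> A}) (alphaB : {linear B -> B}) :
  hcs_matched_i mu alphaA alphaB lA rA lB rB ->
  hcs_matched_ii mu alphaA lA rA lB rB ->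
  homLie_matched (commutator mu) (diff_bilin lA rA) (diff_bilin lB rB)
    alphaA alphaB.
Proof.
move=> matched_i matched_ii x y a /=.
apply: (eq_linear_combination _ _ _ _ _ (esym (matched_i x y a))).
apply: (eq_linear_combination _ _ _ _ _ (matched_i y x a)).
(* Condition (ii) is itself skew in [x] and [y]: one instance suffices. *)
apply: (eq_linear_combination _ _ _ _ _ (matched_ii x y a)).
rewrite /diff_bilin /commutator !(linearBl, linearBr) /=.
zmod_cancel.
Qed.

Theorem corollary3p10 (K : fieldType) (A B : lmodType K)
    (muA : {bilinear A -> A -> A}) (muB : {bilinear B -> B -> B})
    (lA rA : {bilinear A -> B -> B}) (lB rB : {bilinear B -> A -> A})
    (alphaA : {linear A -> A}) (alphaB : {linear B -> B}) :
  hcs_matched_pair muA muB lA rA lB rB alphaA alphaB ->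
  homLie_matched_pair (commutator muA) (commutator muB)
    (diff_bilin lA rA) (diff_bilin lB rB) alphaA alphaB.
Proof.
case=> hcsA hcsB bimodB bimodA mp_i mp_ii mp_iii mp_iv; split.
- exact: commutator_hom_Lie hcsA.
- exact: commutator_hom_Lie hcsB.
- exact: hcs_bimodule_diff_repr bimodB.
- exact: hcs_bimodule_diff_repr bimodA.
- exact: hcs_matched_diff mp_i mp_ii.
- exact: hcs_matched_diff mp_iii mp_iv.
Qed.
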